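(* Let $b\ge 2$ and $N\ge 1$ be integers such that $b\nmid N$. Then there exists an integer $M\ge 1$ such that $$N\cdot M=(N\cdot M)^R,$$ where $(N\cdot M)^R$ is the reversal of $N\cdot M$ written in base $b$.
   Context: The reversal $K^R$ (in base $b$) of a positive integer $K$ is the integer obtained by writing the base $b$ digits of $K$ (without leading zeros) in reverse order, i.e. if $K=\sum_{i=0}^{d-1} n_i b^i$ with $0\le n_i<b$, $n_{d-1}\neq 0$, then $K^R=\sum_{i=0}^{d-1} n_i b^{d-1-i}$. *)

(* Defs.v *)
From mathcomp Require Import all_boot.

Set Implicit Arguments.
Unset Strict Implicit.
Unset Printing Implicit Defensive.

Definition digit (b K i : nat) : nat := (K %/ b ^ i) %% b.

(* For 1 < b and 0 < K, the leading base b digit of K has index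
   trunc_log b K, so K has (trunc_log b K).+1 digits. *)
Definition reversal (b K : nat) : nat :=
  \sum_(i < (trunc_log b K).+1) digit b K i * b ^ (trunc_log b K - i).

Lemma digits_lt (b m : nat) (n : nat -> nat) :
  (forall i, i < m -> n i < b) -> \sum_(i < m) n i * b ^ i < b ^ m.
Proof.
elim: m => [|m IHm] n_lt; first by rewrite big_ord0.
have {}IHm := IHm (fun i lim => n_lt i (ltnW lim)).
rewrite big_ord_recr /= expnS.
apply: (@leq_trans ((n m).+1 * b ^ m)); first by rewrite mulSn ltn_add2r.
by rewrite leq_mul2r n_lt ?orbT.
Qed.

Lemma digit_digits (b m k : nat) (n : nat -> nat) :
  (forall i, i < m -> n i < b) -> k < m ->
  digit b (\sum_(i < m) n i * b ^ i) k = n k.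
Proof.
rewrite /digit; elim: m k n => [|m IHm] k n n_lt k_lt //.
have n0_lt := n_lt 0 isT; have b_gt0 : 0 < b := leq_ltn_trans (leq0n _) n0_lt.
rewrite big_ord_recl muln1 /=.
have -> : \sum_(i < m) n (bump 0 i) * b ^ bump 0 i =
          (\sum_(i < m) n i.+1 * b ^ i) * b.
  by rewrite big_distrl; apply: eq_bigr => i _; rewrite expnSr mulnA.
case: k k_lt => [|k] k_lt; first by rewrite divn1 addnC modnMDl modn_small.
rewrite expnS divnMA addnC divnMDl // (divn_small n0_lt) addn0.
by apply: (IHm k (n \o succn)) => // i i_lt; apply: n_lt.
Qed.

Lemma reversal_digits (b d : nat) (n : nat -> nat) :
  1 < b -> (forall i, i < d.+1 -> n i < b) -> n d != 0 ->
  reversal b (\sum_(i < d.+1) n i * b ^ i) =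
  \sum_(i < d.+1) n i * b ^ (d - i).
Proof.
move=> b_gt1 n_lt nd_neq0; rewrite /reversal.
have -> : trunc_log b (\sum_(i < d.+1) n i * b ^ i) = d.
  apply: trunc_log_eq => //; rewrite digits_lt // andbT big_ord_recr /=.
  by rewrite (leq_trans _ (leq_addl _ _)) // leq_pmull // lt0n.
by apply: eq_bigr => i _; rewrite digit_digits.
Qed.

(* Main.v *)
Require Import Defs.
From mathcomp Require Import all_boot.

(** Write [N] with [k] digits, padding with leading zeros, put the mirror image
    in front, and repeat the resulting word of length [2k] a total of [N] times.
    This gives a palindrome, whose outermost digits are the last digit of [N],
    nonzero exactly because [b] does not divide [N]. With [G] the sum of the
    [b ^ (2kj)] for [j < N] and [R] the number spelled by the mirror image, its
    value is [(N + b ^ k * R) * G] ([sum_periodic]). The first summand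
    [N * G] is a multiple of [N]; for the second, choose [k] such that [b ^ k]
    is idempotent modulo [N] ([expn_idempotent_mod]): each of the [N] terms of
    [b ^ k * G] is then congruent to [b ^ k], so they add up to a multiple of
    [N]. Idempotence, rather than [b ^ k = 1], is what makes the
    argument work when [b] and [N] share prime factors. *)

(** By pigeonhole the powers of [b] are eventually periodic modulo [N], with
    preperiod and period [p] at most [N]; any multiple [k] of [p] beyond the
    preperiod gives an idempotent, and [k = N * p] is one. The bound [N <= k]
    ensures that [N] fits in [k] digits. *)
Lemma expn_idempotent_mod (b N : nat) : 0 < N ->
  exists2 k, N <= k & b ^ (k + k) = b ^ k %[mod N].
Proof.
move=> N_gt0.
pose f (i : 'I_N.+1) := Ordinal (ltn_pmod (b ^ i) N_gt0).
have [i [j [lt_ij eq_ij]]] : exists i j : 'I_N.+1, i < j /\ f i = f j.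
  have /injectivePn[x [y neq_xy eq_f]] : ~~ injectiveb f.
    by apply/injectiveP => /leq_card; rewrite !card_ord ltnn.
  case: (ltngtP x y) => [lt_xy | lt_yx | /val_inj eq_xy].
  - by exists x, y.
  - by exists y, x.
  - by rewrite eq_xy eqxx in neq_xy.
have {}eq_ij : b ^ i = b ^ j %[mod N] by case: eq_ij.
have le_iN : i <= N by rewrite -ltnS.
pose p := j - i.
have p_gt0 : 0 < p by rewrite subn_gt0.
have periodic s t : i <= s -> b ^ (s + t * p) = b ^ s %[mod N].
  move=> le_is; elim: t => [|t IHt]; first by rewrite mul0n addn0.
  have -> : s + t.+1 * p = j + (s - i + t * p).
    by rewrite mulSn !addnA !addnBA ?(ltnW lt_ij) // [s + j]addnC.
  by rewrite expnD -modnMml -eq_ij modnMml -expnD -IHt addnA subnKC.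
have le_Nk : N <= N * p by rewrite leq_pmulr.
by exists (N * p); rewrite // periodic // (leq_trans le_iN).
Qed.

Lemma sum_digits (b m k : nat) :
  \sum_(i < k) digit b m i * b ^ i = m %% b ^ k.
Proof.
elim: k => [|k IHk]; first by rewrite big_ord0 modn1.
rewrite big_ord_recr /= IHk /digit modn_divl -expnS addnC.
by rewrite [in RHS](divn_eq (m %% b ^ k.+1) (b ^ k)) modn_dvdm ?dvdn_exp2l.
Qed.

(** Block number [j] contributes the value of one period, shifted by [l * j]
    places. *)
Lemma sum_periodic (b l t : nat) (n : nat -> nat) :
  (forall i, n (l + i) = n i) ->
  \sum_(i < t * l) n i * b ^ i =
  (\sum_(i < l) n i * b ^ i) * \sum_(j < t) b ^ (l * j).
Proof.
move=> n_per; elim: t => [|t IHt]; first by rewrite !big_ord0 muln0.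
rewrite mulSn big_split_ord big_ord_recl /= muln0 expn0 mulnDr muln1.
congr (_ + _); under eq_bigr do rewrite n_per expnD mulnCA.
rewrite -big_distrr /= IHt mulnCA big_distrr /=; congr (_ * _).
by apply: eq_bigr => j _; rewrite /bump /= add1n mulnS expnD.
Qed.

(** Reversing a word made of [t] blocks of length [l] reverses each block. *)
Lemma modn_reflect (l t i : nat) : i < t * l ->
  ((t * l).-1 - i) %% l = l.-1 - i %% l.
Proof.
case: l => [|l]; first by rewrite muln0.
move=> i_lt; have q_lt : i %/ l.+1 < t by rewrite ltn_divLR.
rewrite {1}(divn_eq i l.+1); have := ltn_pmod i (ltn0Sn l).
move: (i %/ l.+1) (i %% l.+1) q_lt => q r /subnKC <- r_le.
rewrite addSn mulSn mulnDl addSn /= addnCA subnDl addnC.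
by rewrite -addnBA // modnMDl modn_small // ltnS leq_subr.
Qed.

Lemma reversal_palindrome (b d : nat) (n : nat -> nat) :
  1 < b -> (forall i, i < d.+1 -> n i < b) -> n d != 0 ->
  (forall i, i <= d -> n (d - i) = n i) ->
  reversal b (\sum_(i < d.+1) n i * b ^ i) = \sum_(i < d.+1) n i * b ^ i.
Proof.
move=> b_gt1 n_lt nd_neq0 n_sym.
rewrite reversal_digits // [RHS](reindex_inj rev_ord_inj) /=.
by apply: eq_bigr => i _; rewrite subSS n_sym // -ltnS.
Qed.

Theorem theorem2 (b N : nat) (hb : 2 <= b) (hN : 1 <= N) (hbN : ~~ (b %| N)) :
  exists M : nat, 1 <= M /\ N * M = reversal b (N * M).
Proof.
have b_gt0 : 0 < b by apply: ltnW.
have [k le_Nk idem_bk] := expn_idempotent_mod b N hN.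
have k_gt0 : 0 < k by apply: leq_trans le_Nk.
pose l := k + k; have l_gt0 : 0 < l by rewrite addn_gt0 k_gt0.
(* The reflection r |-> l - 1 - r exchanges the two halves of a period, so
   reading off the smaller of r and its mirror image runs through the digits
   of N upwards and then downwards. *)
pose n i := digit b N (minn (i %% l) (l.-1 - i %% l)).
have n_lt i : n i < b by rewrite /n /digit ltn_pmod.
have n_per i : n (l + i) = n i by rewrite /n modnDl.
pose d := (N * l).-1.
have dE : d.+1 = N * l by rewrite prednK // muln_gt0 hN.
have n_sym i : i <= d -> n (d - i) = n i.
  move=> le_id; have r_lt := ltn_pmod i l_gt0.
  rewrite /n modn_reflect -?dE // minnC subKn //.
  by rewrite -ltnS prednK.
have nd_neq0 : n d != 0.
  rewrite -[d]subn0 n_sym // /n mod0n min0n /digit expn0 divn1.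
  by rewrite /dvdn in hbN.
have P_rev := reversal_palindrome b d n hb (fun i _ => n_lt i) nd_neq0 n_sym.
have P_gt0 : 0 < \sum_(i < d.+1) n i * b ^ i.
  rewrite big_ord_recr /= addn_gt0 muln_gt0 [0 < n d]lt0n nd_neq0.
  by rewrite expn_gt0 b_gt0 orbT.
suff /dvdnP[M P_eq] : N %| \sum_(i < d.+1) n i * b ^ i.
  exists M; rewrite mulnC -P_eq P_rev; split=> //.
  by move: P_gt0; rewrite P_eq muln_gt0 => /andP[].
have half_eq : \sum_(i < k) n i * b ^ i = N.
  have N_lt : N < b ^ k by exact: leq_ltn_trans le_Nk (ltn_expl k hb).
  rewrite -[RHS](modn_small N_lt) -sum_digits; apply: eq_bigr => i _.
  have i_lt := ltn_ord i.
  have i2_le : i + i <= l.-1.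
    by rewrite -ltnS prednK // -addSn leq_add // ltnW.
  rewrite /n modn_small ?ltn_addr // (minn_idPl _) //.
  by rewrite leq_subRL // (leq_trans (leq_addr i i)).
have period_eq : \sum_(i < l) n i * b ^ i =
                 N + b ^ k * \sum_(i < k) n (k + i) * b ^ i.
  rewrite big_split_ord /= half_eq big_distrr /=.
  by under eq_bigr do rewrite expnD mulnCA.
rewrite dE sum_periodic // period_eq mulnDl (dvdn_addr _ (dvdn_mulr _ (dvdnn N))).
rewrite mulnAC; apply: dvdn_mulr; rewrite big_distrr /= /dvdn -modn_summ.
have bk_mod : b ^ k * b ^ l = b ^ k %[mod N].
  by rewrite -expnD /l addnA expnD -modnMml idem_bk modnMml -expnD.
have term_mod (j : 'I_N) : true -> b ^ k * b ^ (l * j) %% N = b ^ k %% N.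
  move=> _; elim: (nat_of_ord j) => [|j' IHj]; first by rewrite muln0 muln1.
  by rewrite mulnS expnD mulnA -modnMml bk_mod modnMml.
by rewrite (eq_bigr _ term_mod) sum_nat_const card_ord modnMr.
Qed.
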